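(* Let $d\ge 2$ and let $X_1,\dots,X_d$ be non-negative random variables. Let $F$ be the distribution function of $X_1$; assume $\sup\{x:F(x)<1\}=\infty$ and $F\in MDA(\Lambda)$ with norming constants $a_n>0$, $b_n\in\mathbb{R}$ and auxiliary function $f$. Assume (i) for all $1\le i\ne j\le d$ and all $t>0$, $\lim_{x\to\infty}\dfrac{P(X_j>t f(x),\,X_i>x)}{P(X_i>x)}=0$; (ii) for all $1\le i<j\le d$ there exists $L_{ij}>0$ such that either $\lim_{x\to\infty}\dfrac{P(X_i>L_{ij}f(x),\,X_j>L_{ij}f(x))}{P(X_i>x)}=0$ or $\lim_{x\to\infty}\dfrac{P(X_i>L_{ij}f(x),\,X_j>L_{ij}f(x))}{P(X_j>x)}=0$; (iii) $\lim_{x\to\infty}\dfrac{P(X_i>x)}{P(X_1>x)}=c_i\in[0,\infty)$ for $i=2,\dots,d$. Let $S_d=X_1+X_2+\dots+X_d$. Then for every $x\in\mathbb{R}$, $$\lim_{n\to\infty}nP(S_d>a_nx+b_n)=\Bigl(1+\sum_{i=2}^dc_i\Bigr)e^{-x},$$ and hence $$\lim_{x\to\infty}\frac{P(S_d>x)}{P(X_1>x)}=1+\sum_{i=2}^dc_i.$$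
   Context: $MDA(\Lambda)$ is the maximal domain of attraction of the Gumbel distribution $\Lambda(x)=\exp\{-e^{-x}\}$: the class of distribution functions $F$ for which there exist norming constants $a_n>0$, $b_n\in\mathbb{R}$ with $\lim_{n\to\infty}n\bar F(a_nx+b_n)=e^{-x}$ for all $x\in\mathbb{R}$, where $\bar F=1-F$. When $F$ has infinite right endpoint, $F\in MDA(\Lambda)$ is equivalent to the existence of an auxiliary function $f$: a positive function with derivative converging to $0$ at infinity, self-neglecting (i.e. $\lim_{t\to\infty}f(t+xf(t))/f(t)=1$ for all $x\in\mathbb{R}$), such that $\lim_{t\to\infty}\bar F(t+xf(t))/\bar F(t)=e^{-x}$ for all $x\in\mathbb{R}$. The function $f$ in the claim is such an auxiliary function of $F$, the distribution function of $X_1$. *)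

(* Defs.v *)
From HB Require Import structures.
From mathcomp Require Import all_boot all_order all_algebra.
From mathcomp Require Import all_classical all_reals all_analysis.

Set Implicit Arguments.
Unset Strict Implicit.
Unset Printing Implicit Defensive.

Import Order.TTheory GRing.Theory Num.Theory.
Import numFieldNormedType.Exports.

Local Open Scope classical_set_scope.
Local Open Scope ring_scope.

(* Distribution functions have type [R -> \bar R], the type of [cdf X].
   Quotients of probabilities are taken in [\bar R], where [p / 0] is [+oo] for
   [0 < p] and [0 / 0] is [0].  They are the real quotients wherever the
   denominator is positive, and a vanishing denominator can therefore never
   make a condition "quotient tends to 0" hold while its numerator is positive
   (as the convention [p / 0 = 0] of the field [R] would). *)

Definition survival (R : realType) (F : R -> \bar R) (x : R) : \bar R :=
  (1 - F x)%E.

Definition right_endpoint (R : realType) (F : R -> \bar R) : \bar R :=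
  ereal_sup [set x%:E | x in [set x : R | (F x < 1)%E]].

Definition in_MDA_Gumbel_with (R : realType) (F : R -> \bar R) (a b : nat -> R) :=
  (forall n, (0 < n)%N -> 0 < a n) /\
  forall x : R,
    (n%:R%:E * survival F (a n * x + b n))%E @[n --> \oo] --> (expR (- x))%:E.

(* An auxiliary function matters only near infinity: it is a function on some
   half-line [(t0, +oo)], so positivity and differentiability are required
   there, the values of the total function [f] below [t0] being junk. *)
Definition auxiliary_function (R : realType) (F : R -> \bar R) (f : R -> R) :=
  [/\ \forall t \near +oo, 0 < f t /\ derivable f t 1,
      derive1 f t @[t --> +oo] --> (0 : R),
      forall x : R, f (t + x * f t) / f t @[t --> +oo] --> (1 : R) &
      forall x : R, (survival F (t + x * f t) / survival F t)%E @[t --> +oo]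
        --> (expR (- x))%:E].

(* Main.v *)
(* Write G x = P(X_1 > x).  All limits are reduced to P(S > x) / G x.
   From below: S exceeds x as soon as some X_i does, and by Bonferroni the
   overlaps cost at most the P(X_i > x, X_j > x), which are o(G x) because
   f x <= x eventually.
   From above: fix u > 0.  If S > x then either some X_i > x - u f x, or two of
   the X_i exceed L f x, or some X_i > x - d L f x while another X_j exceeds
   (u / d) f x.  The second event is o(G x) by (ii), the third by (i) applied
   at y = x - d L f x, since f y ~ f x and G y ~ e^(d L) G x.  The first has
   probability at most \sum_i P(X_i > x - u f x) ~ e^u (\sum_i c_i) G x, and u
   is arbitrarily small.
   The statement on the norming constants is the same limit along
   x = a_n t + b_n, which tends to +oo because n G(a_n t + b_n) converges. *)

Require Import Defs.
From HB Require Import structures.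
From mathcomp Require Import all_boot all_order all_algebra.
From mathcomp Require Import all_classical all_reals all_analysis.
From mathcomp Require Import lra.

Set Implicit Arguments.
Unset Strict Implicit.
Unset Printing Implicit Defensive.

Import Order.TTheory GRing.Theory Num.Theory.
Import numFieldNormedType.Exports.

Local Open Scope classical_set_scope.
Local Open Scope ring_scope.

(** * Extended quotients against real quotients *)

(** Where [D x] vanishes and [N x] does not, the quotient is infinite, which convergence to 0
    eventually excludes. The product form of the conclusion also covers points where both vanish. *)
Lemma cvg0_ratio_le (T : Type) (F : set_system T) {FF : Filter F}
    (R : realType) (N D : T -> R) (e : R) :
    (forall x, 0 <= N x) -> (forall x, 0 <= D x) -> 0 < e ->
    ((N x)%:E / (D x)%:E)%E @[x --> F] --> 0%E ->
  \forall x \near F, N x <= e * D x.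
Proof.
move=> N0 D0 e0 /fine_cvgP[finND /cvgrPdist_lt/(_ _ e0) ltND].
near=> x.
have : (((N x)%:E / (D x)%:E)%E \is a fin_num) by near: x.
have : `|0 - fine ((N x)%:E / (D x)%:E)%E| < e by near: x.
rewrite inver sub0r normrN; case: eqP => [D0x|/eqP Dn0].
  have [->|Nn0] := eqVneq (N x) 0; first by rewrite D0x mulr0.
  by rewrite gt0_muley// lte_fin lt_neqAle eq_sym Nn0 N0.
have Dgt0 : 0 < D x by rewrite lt_neqAle eq_sym Dn0 D0.
rewrite -EFinM /= ger0_norm ?divr_ge0// => ltNDe _.
by rewrite -ler_pdivrMr// ltW.
Unshelve. all: by end_near. Qed.

Lemma cvg_EFin_ratio (T : Type) (F : set_system T) {FF : Filter F}
    (R : realType) (N D : T -> R) (l : R) :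
    (forall x, 0 < D x) ->
  ((N x)%:E / (D x)%:E)%E @[x --> F] --> l%:E <-> N x / D x @[x --> F] --> l.
Proof.
move=> D0.
have -> : (fun x => ((N x)%:E / (D x)%:E)%E) = (fun x => (N x / D x)%:E).
  by apply/funext => x; rewrite inver gt_eqF// -EFinM.
split; last by move=> h; apply: cvg_EFin => //; exact: nearW.
by move=> /fine_cvgP[].
Qed.

(** Serves to trade the denominators P(X_i > x) of (i) and (ii) for P(X_1 > x). As [D] may vanish,
    [N] is bounded by a small multiple of [D] instead of factoring N / G through N / D. *)
Lemma cvg0_ratio_trans (T : Type) (F : set_system T) {FF : Filter F}
    (R : realType) (N D G : T -> R) (l : R) :
    (forall x, 0 <= N x) -> (forall x, 0 <= D x) -> (forall x, 0 < G x) ->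
    ((N x)%:E / (D x)%:E)%E @[x --> F] --> 0%E ->
    D x / G x @[x --> F] --> l ->
  N x / G x @[x --> F] --> (0 : R).
Proof.
move=> N0 D0 G0 ND DG; apply/cvgrPdist_le => e e0.
have K0 : 0 < `|l| + 1 by rewrite ltr_wpDl.
have NleD : \forall x \near F, N x <= e / (`|l| + 1) * D x.
  exact: cvg0_ratio_le (divr_gt0 e0 K0) ND.
have DGle : \forall x \near F, D x / G x <= `|l| + 1.
  by apply: (cvgr_le l DG); rewrite (le_lt_trans (ler_norm l))// ltrDl.
near=> x; rewrite sub0r normrN ger0_norm ?divr_ge0 ?(ltW (G0 _))//.
have le1 : N x <= e / (`|l| + 1) * D x by near: x.
have le2 : D x / G x <= `|l| + 1 by near: x.
rewrite ler_pdivrMr// (le_trans le1)// mulrAC ler_pdivrMr// -mulrA.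
by rewrite ler_pM2l// mulrC -ler_pdivrMr.
Unshelve. all: by end_near. Qed.

(** * Sublinear growth of the auxiliary function *)

(** By the mean value theorem, a derivative eventually at most [(2 * (K + 1))^-1] bounds [K * f x]
    by x / 2 plus a constant. The [K + 1] keeps the slope defined for [K = 0]. *)
Lemma subr_scale_sublinear_cvgy (R : realType) (f : R -> R) (K : R) :
    (\forall t \near +oo, derivable f t 1) ->
    derive1 f t @[t --> +oo] --> (0 : R) -> 0 <= K ->
  x - K * f x @[x --> +oo] --> +oo.
Proof.
move=> df f'0 K0.
have K1 : 0 < 2 * (K + 1) by rewrite mulr_gt0// ltr_wpDl.
have f'le : \forall t \near +oo, derive1 f t <= (2 * (K + 1))^-1.
  by apply: (cvgr_le (0 : R) f'0) => //; rewrite invr_gt0.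
have [t0 [_ Ht0]] : \forall t \near +oo,
    derivable f t 1 /\ derive1 f t <= (2 * (K + 1))^-1.
  by apply: filterS2 df f'le => t.
(* The bounds hold strictly beyond [t0] only, and differentiability is wanted at the left end [s] as
   well. *)
pose s := t0 + 1.
have Hs t : s <= t -> derivable f t 1 /\ derive1 f t <= (2 * (K + 1))^-1.
  by move=> st; apply: Ht0; rewrite (lt_le_trans _ st)// /s ltrDl.
have fle x : s < x -> f x <= f s + (x - s) / (2 * (K + 1)).
  move=> sx.
  have [z zsx Hz] : exists2 z, z \in `]s, x[%R &
      f x - f s = derive1 f z * (x - s).
    apply: MVT => //.
      move=> z /[!in_itv]/= /andP[/ltW/Hs[dz _] _].
      by rewrite derive1E; apply: DeriveDef.
    apply: derivable_within_continuous => z /[!in_itv]/= /andP[sz _].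
    by have [] := Hs _ sz.
  rewrite -lerBlDl Hz mulrC ler_pM2l ?subr_gt0//.
  by move: zsx; rewrite in_itv/= => /andP[/ltW/Hs[_]].
apply/cvgryPge => A; near=> x.
have sx : s < x by near: x; apply: nbhs_pinfty_gt; rewrite num_real.
have := ler_wpM2l K0 (fle _ sx); rewrite mulrDr => Kle.
have : K * ((x - s) / (2 * (K + 1))) <= (x - s) / 2.
  rewrite invfM !mulrA ler_pdivrMr ?ltr_wpDl// mulrAC -!mulrA.
  have : 0 <= (x - s) / 2 by rewrite divr_ge0 ?subr_ge0 ?(ltW sx).
  by move: (_ / 2) => y y0; nra.
have : 2 * (A + K * f s) + `|s| <= x.
  by near: x; apply: nbhs_pinfty_ge; rewrite num_real.
by have := ler_norm (- s); rewrite normrN => ?; lra.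
Unshelve. all: by end_near. Qed.

(** * Real-valued probabilities and Bonferroni bounds *)

Definition prob (d : measure_display) (T : measurableType d) (R : realType)
  (P : probability T R) (A : set T) : R := fine (P A).

Section prob.
Context (d : measure_display) (T : measurableType d) (R : realType).
Variable P : probability T R.
Implicit Types A B : set T.

Lemma probE A : measurable A -> (prob P A)%:E = P A.
Proof. by move=> mA; rewrite fineK// fin_num_measure. Qed.

Lemma prob_ge0 A : 0 <= prob P A.
Proof. exact/fine_ge0. Qed.

Lemma le_prob A B : measurable A -> measurable B -> A `<=` B ->
  prob P A <= prob P B.
Proof. by move=> mA mB AB; rewrite -lee_fin !probE// le_measure ?inE. Qed.

Lemma probU A B : measurable A -> measurable B ->
  prob P (A `|` B) = prob P A + prob P B - prob P (A `&` B).
Proof.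
move=> mA mB; apply: EFin_inj; rewrite EFinB EFinD !probE//.
- by apply: measureUfinr => //; rewrite -ge0_fin_numE// fin_num_measure.
- exact: measurableI.
- exact: measurableU.
Qed.

Lemma probU_le A B : measurable A -> measurable B ->
  prob P (A `|` B) <= prob P A + prob P B.
Proof. by move=> mA mB; rewrite probU// lerBlDr lerDl prob_ge0. Qed.

Lemma prob_bigU_le (I : Type) (s : seq I) (Q : pred I) (A : I -> set T) :
    (forall i, measurable (A i)) ->
  prob P (\big[setU/set0]_(i <- s | Q i) A i) <=
    \sum_(i <- s | Q i) prob P (A i).
Proof.
move=> mA; elim: s => [|i s IH]; first by rewrite !big_nil /prob measure0.
rewrite !big_cons; case: ifP => // _.
apply: le_trans (probU_le (mA i) _) _; first exact: bigsetU_measurable.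
by rewrite lerD2l.
Qed.

(* The second Bonferroni inequality, with every pair counted twice. *)
Lemma prob_bigU_ge (I : eqType) (s : seq I) (A : I -> set T) :
    (forall i, measurable (A i)) -> uniq s ->
  \sum_(i <- s) prob P (A i)
    - \sum_(i <- s) \sum_(j <- s | i != j) prob P (A i `&` A j)
  <= prob P (\big[setU/set0]_(i <- s) A i).
Proof.
move=> mA; elim: s => [_|k s IH /= /andP[ks us]].
  by rewrite !big_nil /prob measure0 subrr.
rewrite !big_cons eqxx /= probU//; last exact: bigsetU_measurable.
have := IH us; rewrite lerBlDr.
(* The condition is vacuous because [k] does not occur in [s]. *)
have -> : \sum_(j <- s | k != j) prob P (A k `&` A j)
    = \sum_(j <- s) prob P (A k `&` A j).
  rewrite big_seq_cond [RHS]big_seq; apply: eq_bigl => j.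
  by case: (boolP (j \in s)) => //= js; apply: contraNneq ks => ->.
have : prob P (A k `&` \big[setU/set0]_(j <- s) A j)
    <= \sum_(j <- s) prob P (A k `&` A j).
  rewrite big_distrr/=; apply: (prob_bigU_le _ (fun=> true)) => j.
  exact: measurableI.
(* The row of [k] alone pays for the overlap with [A k]; the added column of [k] is non-negative. *)
have : \sum_(i <- s) \sum_(j <- s | i != j) prob P (A i `&` A j)
    <= \sum_(i <- s) \sum_(j <- k :: s | i != j) prob P (A i `&` A j).
  apply: ler_sum => i _; rewrite big_cons; case: ifP => // _.
  by rewrite lerDr prob_ge0.
by lra.
Qed.

End prob.

(** * Finite sums: limits and a case split for large values *)

Lemma cvg_sumr (T I : Type) (F : set_system T) {FF : Filter F} (R : realType)
    (s : seq I) (Q : pred I) (f : I -> T -> R) (l : I -> R) :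
    (forall i, Q i -> f i x @[x --> F] --> l i) ->
  \sum_(i <- s | Q i) f i x @[x --> F] --> \sum_(i <- s | Q i) l i.
Proof. by move=> fl; apply: cvg_big => //; exact: add_continuous. Qed.

(* If the sum exceeds [y] although no term exceeds [y - e] and no two terms
   exceed [L], then the only term that may exceed [L] makes up for all but
   [d * L] of the sum, while the others still contribute more than [e]. *)
Lemma sum_gt_cases (R : realType) (d : nat) (x : 'I_d -> R) (y L e : R) :
    (0 < d)%N -> 0 <= L -> 0 <= e -> y < \sum_(i < d) x i ->
  [\/ exists i, y - e < x i,
      exists i j, [/\ i != j, L < x i & L < x j] |
      exists i j, [/\ i != j, e / d%:R < x j & y - d%:R * L < x i]].
Proof.
move=> d0 L0 e0 yS.
have [h1|h1] := pselect (exists i, y - e < x i); first exact: Or31.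
have [h2|h2] := pselect (exists i j, [/\ i != j, L < x i & L < x j]).
  exact: Or32.
apply: Or33.
(* [i] is the index of the only term above [L] if there is one, and arbitrary otherwise. *)
have [i Hi] : exists i, forall j, j != i -> x j <= L.
  have [[i Li]|noL] := pselect (exists i, L < x i).
    exists i => j ji; rewrite leNgt; apply/negP => Lj.
    by apply: h2; exists i, j; rewrite eq_sym.
  exists (Ordinal d0) => j _; rewrite leNgt; apply/negP => Lj.
  by apply: noL; exists j.
have sum_others (M : R) : 0 <= M -> (forall j, j != i -> x j <= M) ->
    \sum_(j < d) x j <= x i + d%:R * M.
  move=> M0 HM; rewrite (bigD1 i)//= lerD2l.
  apply: (@le_trans _ _ (\sum_(j < d | j != i) M)); first exact: ler_sum.
  rewrite sumr_const -[leLHS]mulr_natl ler_wpM2r// ler_nat.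
  by rewrite (leq_trans (max_card _))// card_ord.
have [[j [ji ej]]|nj] := pselect (exists j, j != i /\ e / d%:R < x j).
  exists i, j; split; rewrite // 1?eq_sym//.
  by rewrite ltrBlDr (lt_le_trans yS)// sum_others.
(* All other terms are now at most [e / d], so the sum is at most [x i + e]. *)
exfalso; apply: h1; exists i; rewrite ltrBlDr (lt_le_trans yS)//.
have -> : x i + e = x i + d%:R * (e / d%:R).
  by rewrite mulrCA divff ?mulr1// pnatr_eq0 -lt0n.
apply: sum_others; first by rewrite divr_ge0.
by move=> j ji; rewrite leNgt; apply/negP => ej; apply: nj; exists j.
Qed.

(** * Measurability of tail events *)

Lemma measurable_gt (d : measure_display) (T : measurableType d)
    (R : realType) (X : T -> R) (y : R) :
  measurable_fun setT X -> measurable [set w | y < X w].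
Proof.
move=> mX; have -> : [set w | y < X w] = setT `&` X @^-1` `]y, +oo[.
  by apply/seteqP; split => w /=; rewrite in_itv/= andbT => // -[].
exact: mX.
Qed.

Lemma measurable_gt2 (d : measure_display) (T : measurableType d)
    (R : realType) (X Y : T -> R) (x y : R) :
    measurable_fun setT X -> measurable_fun setT Y ->
  measurable [set w | x < X w /\ y < Y w].
Proof.
move=> mX mY.
by apply: (@measurableI _ _ [set w | _] [set w | _]); exact: measurable_gt.
Qed.

(** * The tail of the sum relative to a positive function [G] *)

Section sum_tail.
Context (disp : measure_display) (T : measurableType disp) (R : realType).
Context (P : probability T R) (d : nat) (X : 'I_d -> {RV P >-> R}).
Context (f G : R -> R) (c : 'I_d -> R).

Let tail i x := prob P [set w | x < X i w].
(** As in (i), [u] is the moderate threshold, for [X j], and [v] the large one, for [X i]. *)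
Let joint i j (u v : R) := prob P [set w | u < X j w /\ v < X i w].
Let S w := \sum_(i < d) X i w.

Hypothesis G_gt0 : forall x, 0 < G x.
Hypothesis G_aux :
  forall y, G (x + y * f x) / G x @[x --> +oo] --> expR (- y).
Hypothesis f_gt0 : \forall x \near +oo, 0 < f x.
Hypothesis f_self : forall y, f (x + y * f x) / f x @[x --> +oo] --> (1 : R).
Hypothesis f_sub : forall K, 0 <= K -> x - K * f x @[x --> +oo] --> +oo.
Hypothesis tail_ratio : forall i, tail i x / G x @[x --> +oo] --> c i.
Hypothesis joint_ratio : forall i j t, i != j -> 0 < t ->
  joint i j (t * f x) x / G x @[x --> +oo] --> (0 : R).

Let mX i : measurable_fun setT (X i).
Proof. exact: measurable_funP. Qed.

Let mS : measurable_fun setT S.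
Proof. exact: measurable_sum. Qed.

Lemma sum_tail_ratio_ge (e : R) : (forall i w, 0 <= X i w) -> 0 < e ->
  \forall x \near +oo,
    \sum_(i < d) c i - e <= prob P [set w | x < S w] / G x.
Proof.
move=> X0 e0.
have fle : \forall x \near +oo, f x <= x.
  have /cvgryPge/(_ 0) := f_sub ler01.
  by apply: filterS => x; rewrite mul1r subr_ge0.
(* This is (i) with t = 1, since exceeding x implies exceeding [f x]. *)
have both i j : i != j -> joint i j x x / G x @[x --> +oo] --> (0 : R).
  move=> ij; apply: (squeeze_cvgr _ (cvg_cst 0) (joint_ratio ij ltr01)).
  near=> x; rewrite divr_ge0 ?prob_ge0 ?(ltW (G_gt0 _))//=.
  rewrite ler_pM2r ?invr_gt0// le_prob//; [exact: measurable_gt2..|].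
  have fx : f x <= x by near: x.
  by move=> w /= [? ?]; split=> //; rewrite mul1r (le_lt_trans fx).
have lowc : \sum_(i < d) (tail i x / G x)
      - \sum_(i < d) \sum_(j < d | i != j) joint j i x x / G x @[x --> +oo]
    --> \sum_(i < d) c i - \sum_(i < d) \sum_(j < d | i != j) (0 : R).
  apply: cvgB; apply: cvg_sumr => i _; first exact: tail_ratio.
  by apply: cvg_sumr => j ij; apply: both; rewrite eq_sym.
rewrite (_ : \sum_(i < d) \sum_(j < d | i != j) (0 : R) = 0) in lowc;
  last first.
  by apply: big1 => i _; exact: big1.
rewrite subr0 in lowc.
have lowe : \forall x \near +oo, \sum_(i < d) c i - e <=
    \sum_(i < d) (tail i x / G x)
      - \sum_(i < d) \sum_(j < d | i != j) joint j i x x / G x.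
  by apply: (cvgr_ge _ lowc); rewrite gtrDl oppr_lt0.
near=> x; apply: (@le_trans _ _ (\sum_(i < d) (tail i x / G x)
      - \sum_(i < d) \sum_(j < d | i != j) joint j i x x / G x)).
  by near: x.
rewrite -mulr_suml; under [X in _ - X]eq_bigr do rewrite -mulr_suml.
rewrite -mulr_suml -mulrBl ler_pM2r ?invr_gt0//.
have mA i : measurable [set w | x < X i w] by exact: measurable_gt.
apply: (le_trans (prob_bigU_ge P mA (index_enum_uniq _))).
apply: le_prob.
- exact: bigsetU_measurable.
- exact: measurable_gt.
- move=> w; rewrite -bigcup_seq => -[i _] /= xXi.
  by rewrite (lt_le_trans xXi)// /S (bigD1 i)//= lerDl sumr_ge0.
Unshelve. all: by end_near. Qed.

(** With y = x - K f x, which tends to infinity, the quotient is (h y / G y)(G y / G x), and the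
    last factor tends to e^K. *)
Lemma cvg_shift_ratio (h : R -> R) (l K : R) : 0 <= K ->
    h x / G x @[x --> +oo] --> l ->
  h (x - K * f x) / G x @[x --> +oo] --> l * expR K.
Proof.
move=> K0 hl; have GK := @G_aux (- K); rewrite opprK in GK.
have hK : h (x - K * f x) / G (x - K * f x) @[x --> +oo] --> l.
  exact: (cvg_comp (fun x => x - K * f x) (fun y => h y / G y) (f_sub K0) hl).
apply: cvg_trans (cvgM hK GK); apply: near_eq_cvg; near=> x => /=.
by rewrite mulNr mulrA divfK// gt_eqF.
Unshelve. all: by end_near. Qed.

(** With y = x - K f x, eventually f y <= 2 f x, so exceeding t f x implies exceeding (t / 2) f y.
    Hence (i) at y with t / 2 gives the bound. *)
Lemma joint_shift_ratio i j (K t : R) : i != j -> 0 <= K -> 0 < t ->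
  joint i j (t * f x) (x - K * f x) / G x @[x --> +oo] --> (0 : R).
Proof.
move=> ij K0 t0.
have t20 : 0 < t / 2 by rewrite divr_gt0.
have := cvg_shift_ratio K0 (joint_ratio ij t20); rewrite mul0r => bnd.
apply: (squeeze_cvgr _ (cvg_cst 0) bnd).
have fself2 : \forall x \near +oo, f (x + (- K) * f x) / f x <= 2.
  by apply: (cvgr_le _ (@f_self (- K))); rewrite ltr1n.
near=> x; rewrite divr_ge0 ?prob_ge0 ?(ltW (G_gt0 _))//=.
rewrite ler_pM2r ?invr_gt0// le_prob//;
  [exact: measurable_gt2|exact: measurable_gt2|].
have fx0 : 0 < f x by near: x.
have : f (x + (- K) * f x) / f x <= 2 by near: x.
rewrite mulNr ler_pdivrMr// => fle w /= [tw ?]; split=> //.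
apply: le_lt_trans tw; rewrite -mulrA ler_pM2l//.
by rewrite ler_pdivrMl.
Unshelve. all: by end_near. Qed.

Lemma sum_tail_ratio_le (L e : R) : (0 < d)%N -> 0 < L -> 0 < e ->
    (forall i j, i != j ->
      joint i j (L * f x) (L * f x) / G x @[x --> +oo] --> (0 : R)) ->
  \forall x \near +oo,
    prob P [set w | x < S w] / G x <= \sum_(i < d) c i + e.
Proof.
move=> d0 L0 e0 big2.
(* Continuity of exp at 0 yields a [u > 0] whose factor e^u costs less than [e]. *)
have expc : (\sum_(i < d) c i) * expR u @[u --> (0 : R)^'+]
    --> \sum_(i < d) c i.
  rewrite -[X in _ --> X]mulr1 -expR0.
  apply: cvgMl_tmp; apply: cvg_at_right_filter; exact: continuous_expR.
have expe : \forall u \near (0 : R)^'+,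
    (\sum_(i < d) c i) * expR u < \sum_(i < d) c i + e.
  by apply: (cvgr_lt _ expc); rewrite ltrDl.
have [u u0 ue] : exists2 u, 0 < u &
    (\sum_(i < d) c i) * expR u < \sum_(i < d) c i + e.
  near ((0 : R)^'+) => u; exists u => //; near: u; exact: expe.
(* The three sums match the three cases of [sum_gt_cases] with thresholds [L * f x] and [u * f x];
   only the first survives in the limit. *)
pose up x := \sum_(i < d) tail i (x - u * f x) / G x
  + \sum_(i < d) \sum_(j < d | i != j) joint i j (L * f x) (L * f x) / G x
  + \sum_(i < d) \sum_(j < d | i != j)
      joint i j (u / d%:R * f x) (x - d%:R * L * f x) / G x.
have upc : up x @[x --> +oo] --> \sum_(i < d) c i * expR u
    + \sum_(i < d) \sum_(j < d | i != j) (0 : R)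
    + \sum_(i < d) \sum_(j < d | i != j) (0 : R).
  apply: cvgD; first apply: cvgD.
  - by apply: cvg_sumr => i _; apply: cvg_shift_ratio; first exact: ltW.
  - by apply: cvg_sumr => i _; apply: cvg_sumr => j; exact: big2.
  - apply: cvg_sumr => i _; apply: cvg_sumr => j ij.
    apply: joint_shift_ratio => //; first by rewrite mulr_ge0// ltW.
    by rewrite divr_gt0// ltr0n.
have sum0 : \sum_(i < d) \sum_(j < d | i != j) (0 : R) = 0.
  by apply: big1 => i _; exact: big1.
rewrite sum0 !addr0 -mulr_suml in upc.
have upe : \forall x \near +oo, up x <= \sum_(i < d) c i + e.
  exact: (cvgr_le _ upc).
near=> x; apply: (@le_trans _ _ (up x)); last by near: x.
have fx0 : 0 < f x by near: x.
rewrite /up -mulr_suml.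
under [X in _ + X + _]eq_bigr do rewrite -mulr_suml.
under [X in _ + _ + X]eq_bigr do rewrite -mulr_suml.
rewrite -!mulr_suml -!mulrDl ler_pM2r ?invr_gt0//.
pose A i := [set w | x - u * f x < X i w].
pose B i j := [set w | L * f x < X j w /\ L * f x < X i w].
pose C i j := [set w | u / d%:R * f x < X j w /\ x - d%:R * L * f x < X i w].
have mA i : measurable (A i) by exact: measurable_gt.
have mB i j : measurable (B i j) by exact: measurable_gt2.
have mC i j : measurable (C i j) by exact: measurable_gt2.
have mU2 (D : 'I_d -> 'I_d -> set T) : (forall i j, measurable (D i j)) ->
    forall i, measurable (\big[setU/set0]_(j < d | i != j) D i j).
  by move=> mD i; exact: bigsetU_measurable.
have U2 (D : 'I_d -> 'I_d -> set T) : (forall i j, measurable (D i j)) ->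
    prob P (\big[setU/set0]_(i < d) \big[setU/set0]_(j < d | i != j) D i j) <=
    \sum_(i < d) \sum_(j < d | i != j) prob P (D i j).
  move=> mD; apply: le_trans (prob_bigU_le _ _ _ (mU2 _ mD)) _.
  by apply: ler_sum => i _; exact: prob_bigU_le.
have U2P (D : 'I_d -> 'I_d -> set T) w i j : i != j -> D i j w ->
    (\big[setU/set0]_(i < d) \big[setU/set0]_(j < d | i != j) D i j) w.
  move=> ij Dw; rewrite -bigcup_seq; exists i; rewrite /= ?mem_index_enum//.
  by rewrite -bigcup_seq_cond; exists j; rewrite //= mem_index_enum.
pose U := \big[setU/set0]_(i < d) A i.
pose V := \big[setU/set0]_(i < d) \big[setU/set0]_(j < d | i != j) B i j.
pose W := \big[setU/set0]_(i < d) \big[setU/set0]_(j < d | i != j) C i j.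
have mU : measurable U by exact: bigsetU_measurable.
have mV : measurable V by apply: bigsetU_measurable => i _; exact: mU2.
have mW : measurable W by apply: bigsetU_measurable => i _; exact: mU2.
have mUV : measurable (U `|` V) by exact: measurableU.
apply: (@le_trans _ _ (prob P (U `|` V `|` W))).
  apply: le_prob; [exact: measurable_gt|exact: measurableU|].
  move=> w /= xS.
  have [[i Ai]|[i [j [ij Li Lj]]]|[i [j [ij uj Li]]]] :=
    sum_gt_cases d0 (mulr_ge0 (ltW L0) (ltW fx0)) (mulr_ge0 (ltW u0) (ltW fx0))
      xS.
  - left; left; rewrite /U -bigcup_seq.
    by exists i; rewrite //= mem_index_enum.
  - by left; right; apply: (U2P _ _ _ _ ij); split.
  - right; apply: (U2P _ _ _ _ ij); split; last by rewrite -mulrA.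
    by rewrite mulrAC.
apply: le_trans (probU_le P mUV mW) _; apply: lerD; last exact: U2.
apply: le_trans (probU_le P mU mV) _; apply: lerD; last exact: U2.
exact: prob_bigU_le.
Unshelve. all: by end_near. Qed.

Lemma sum_tail_ratio_cvg (L : R) : (0 < d)%N -> (forall i w, 0 <= X i w) ->
    0 < L ->
    (forall i j, i != j ->
      joint i j (L * f x) (L * f x) / G x @[x --> +oo] --> (0 : R)) ->
  prob P [set w | x < S w] / G x @[x --> +oo] --> \sum_(i < d) c i.
Proof.
move=> d0 X0 L0 big2; apply/cvgrPdist_le => e e0.
have lo := sum_tail_ratio_ge X0 e0; have hi := sum_tail_ratio_le d0 L0 e0 big2.
near=> x; rewrite distrC ler_distl; apply/andP; split; near: x => //.
Unshelve. all: by end_near. Qed.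

End sum_tail.

(** * Positivity of the tail and divergence of the norming sequence *)

Lemma survival_cdfE (d : measure_display) (T : measurableType d)
    (R : realType) (P : probability T R) (X : {RV P >-> R}) (x : R) :
  survival (cdf X) x = P [set w | x < X w].
Proof.
rewrite /survival -ccdf_1_cdf /ccdf /distribution /pushforward; congr (P _).
by apply/seteqP; split => w /=; rewrite in_itv/= andbT.
Qed.

(** If P(X > x) were 0, the distribution function would equal 1 beyond x and its right endpoint
    would be at most x. *)
Lemma prob_gt_gt0 (d : measure_display) (T : measurableType d)
    (R : realType) (P : probability T R) (X : {RV P >-> R}) (x : R) :
  right_endpoint (cdf X) = +oo%E -> 0 < prob P [set w | x < X w].
Proof.
move=> endy; rewrite lt_neqAle prob_ge0 andbT eq_sym; apply/eqP => p0.
have mX y : measurable [set w | y < X w].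
  by apply: measurable_gt; exact: measurable_funP.
suff : (right_endpoint (cdf X) <= x%:E)%E by rewrite endy.
apply: ge_ereal_sup => _ [y /= Fy <-]; rewrite lee_fin leNgt; apply/negP => xy.
have py0 : prob P [set w | y < X w] = 0.
  apply/eqP; rewrite eq_le prob_ge0 andbT -p0.
  by apply: le_prob => // w /=; exact: lt_trans.
have := cdf_ccdf_1 X y.
rewrite ccdf_1_cdf -/(survival (cdf X) y) survival_cdfE -probE// py0 adde0.
by move=> F1; rewrite F1 ltxx in Fy.
Qed.

(** Whenever [u n < A], monotonicity keeps [G (u n)] at least [G A > 0], which eventually fails. *)
Lemma nonincreasing_cvg0_cvgy (R : realType) (G : R -> R) (u : nat -> R) :
    (forall x, 0 < G x) -> (forall x y, x <= y -> G y <= G x) ->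
    G (u n) @[n --> \oo] --> (0 : R) ->
  u n @[n --> \oo] --> +oo.
Proof.
move=> G0 Gd Gu; apply/cvgryPge => A.
have : \forall n \near \oo, G (u n) < G A by apply: (cvgr_lt _ Gu).
apply: filterS => n; rewrite leNgt; apply: contraTN => /ltW/Gd.
by rewrite leNgt.
Qed.

(** * Reduction to real quotients over P(X_1 > x), and both limits *)

Theorem corollary2p10 (disp : measure_display) (T : measurableType disp)
    (R : realType) (P : probability T R) (d : nat) (hd : (2 <= d)%N)
    (X : 'I_d -> {RV P >-> R}) (a b : nat -> R) (f : R -> R) (c : 'I_d -> R)
    (* the index of X_1; the indices 2, ..., d are those different from i1 *)
    (i1 := Ordinal (ltnW hd) : 'I_d)
    (F := cdf (X i1) : R -> \bar R)
    (S := fun w : T => \sum_(i < d) X i w)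
    (hX : forall (i : 'I_d) (w : T), 0 <= X i w)
    (hend : right_endpoint F = +oo%E)
    (hMDA : in_MDA_Gumbel_with F a b)
    (hf : auxiliary_function F f)
    (h1 : forall (i j : 'I_d) (t : R), i != j -> 0 < t ->
      (P [set w | (t * f x < X j w)%R /\ (x < X i w)%R] / P [set w | (x < X i w)%R])%E
        @[x --> +oo] --> 0%E)
    (h2 : forall i j : 'I_d, (i < j)%N -> exists2 L : R, 0 < L &
      (P [set w | (L * f x < X i w)%R /\ (L * f x < X j w)%R] / P [set w | (x < X i w)%R])%E
        @[x --> +oo] --> 0%E \/
      (P [set w | (L * f x < X i w)%R /\ (L * f x < X j w)%R] / P [set w | (x < X j w)%R])%E
        @[x --> +oo] --> 0%E)
    (h3 : forall i : 'I_d, i != i1 -> 0 <= c i /\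
      (P [set w | (x < X i w)%R] / P [set w | (x < X i1 w)%R])%E
        @[x --> +oo] --> (c i)%:E) :
  (forall x : R,
    (n%:R%:E * P [set w | (a n * x + b n < S w)%R])%E @[n --> \oo] -->
      ((1 + \sum_(i < d | i != i1) c i) * expR (- x))%:E) /\
  (P [set w | (x < S w)%R] / P [set w | (x < X i1 w)%R])%E @[x --> +oo] -->
    (1 + \sum_(i < d | i != i1) c i)%:E.
Proof.
case: hf => fpos f'0 fself Faux; case: hMDA => _ Fnorm.
have d0 : (0 < d)%N by exact: ltnW.
pose G x := prob P [set w | x < X i1 w].
(* [h3] leaves [c i1] free; the ratio of X_1 to itself supplies the value 1. *)
pose c' i := if i == i1 then 1 else c i.
have mX i : measurable_fun setT (X i) by exact: measurable_funP.
have mS : measurable_fun setT S by exact: measurable_sum.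
have mXgt i x : measurable [set w | x < X i w] by exact: measurable_gt.
have mSgt x : measurable [set w | x < S w] by exact: measurable_gt.
have mX2 i j x y : measurable [set w | x < X i w /\ y < X j w].
  exact: measurable_gt2.
have G0 x : 0 < G x by exact: prob_gt_gt0.
have GE x : (G x)%:E = P [set w | x < X i1 w] by exact: probE.
have FE x : survival F x = (G x)%:E by rewrite /F survival_cdfE GE.
have Gaux y : G (x + y * f x) / G x @[x --> +oo] --> expR (- y).
  have := Faux y; under eq_fun do rewrite !FE.
  by move=> /(cvg_EFin_ratio _ _ G0).
have f0 : \forall x \near +oo, 0 < f x by apply: filterS fpos => x [].
have fsub K : 0 <= K -> x - K * f x @[x --> +oo] --> +oo.
  by apply: subr_scale_sublinear_cvgy f'0; apply: filterS fpos => x [].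
have tails i : prob P [set w | x < X i w] / G x @[x --> +oo] --> c' i.
  rewrite /c'; case: eqVneq => [->|ii1].
    rewrite (_ : (fun x => _) = fun=> 1); first exact: cvg_cst.
    by apply/funext => x; rewrite divff ?gt_eqF ?G0.
  have [_] := h3 i ii1; under eq_fun do rewrite -GE -probE//.
  by move=> /(cvg_EFin_ratio _ _ G0).
(* As [i] is arbitrary, this handles both alternatives of (ii) alike. *)
have toG i (N : R -> set T) : (forall x, measurable (N x)) ->
    (P (N x) / P [set w | (x < X i w)%R])%E @[x --> +oo] --> 0%E ->
    prob P (N x) / G x @[x --> +oo] --> (0 : R).
  move=> mN; under eq_fun do rewrite -!probE//.
  move=> h; apply: (cvg0_ratio_trans _ _ G0 h (tails i)) => x;
    exact: prob_ge0.
have joint i j t : i != j -> 0 < t ->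
    prob P [set w | t * f x < X j w /\ x < X i w] / G x @[x --> +oo] --> (0 : R).
  by move=> ij t0; apply: toG => //; exact: h1.
have big2lt (i j : 'I_d) : (i < j)%N -> exists2 L : R, 0 < L &
    prob P [set w | L * f x < X i w /\ L * f x < X j w] / G x @[x --> +oo]
      --> (0 : R).
  by move=> /h2[L L0 H]; exists L => //; case: H => H; apply: toG H => x.
(* The condition [i != j] stands inside so that [choice] applies to all pairs; the diagonal gets the
   dummy value 1. *)
have big2 (i j : 'I_d) : exists L : R, 0 < L /\ (i != j ->
    prob P [set w | L * f x < X j w /\ L * f x < X i w] / G x @[x --> +oo]
      --> (0 : R)).
  have [ij|ji|/val_inj->] := ltngtP i j.
  - have [L L0 H] := big2lt i j ij; exists L; split=> // _.
    rewrite (_ : (fun x => _) = fun x =>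
      prob P [set w | L * f x < X i w /\ L * f x < X j w] / G x)//.
    apply/funext => x; congr (prob P _ / _).
    by apply/seteqP; split => w [].
  - by have [L L0 H] := big2lt j i ji; exists L.
  - by exists 1; split => //; rewrite eqxx.
(* Raising [L] shrinks the event, so the sum of all the positive constants serves every pair at
   once. *)
have [L Lpos big2L] : exists2 L, 0 < L & forall i j, i != j ->
    prob P [set w | L * f x < X j w /\ L * f x < X i w] / G x @[x --> +oo]
      --> (0 : R).
  have [Lf HL] := choice (fun ij : 'I_d * 'I_d => big2 ij.1 ij.2).
  have leL ij : Lf ij <= \sum_ij Lf ij.
    rewrite (bigD1 ij)//= lerDl sumr_ge0// => kl _.
    by have [/ltW] := HL kl.
  exists (\sum_ij Lf ij) => [|i j ij].
    by apply: lt_le_trans (leL (i1, i1)); have [] := HL (i1, i1).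
  have [_ /(_ ij) Hij] := HL (i, j).
  apply: (squeeze_cvgr _ (cvg_cst 0) Hij); near=> x.
  rewrite divr_ge0 ?prob_ge0 ?(ltW (G0 _))//=.
  rewrite ler_pM2r ?invr_gt0// le_prob//.
  have fx0 : 0 < f x by near: x.
  have leLf := ler_wpM2r (ltW fx0) (leL (i, j)).
  by move=> w /= [? ?]; split; apply: le_lt_trans leLf _.
have main : prob P [set w | x < S w] / G x @[x --> +oo] --> \sum_(i < d) c' i.
  exact: (sum_tail_ratio_cvg G0 Gaux f0 fself fsub tails joint d0 hX
    Lpos big2L).
rewrite (bigD1 i1)//= in main.
rewrite {1}/c' eqxx (eq_bigr c) in main; last first.
  by move=> i /negPf; rewrite /c' => ->.
split; last first.
  by under eq_fun do rewrite -GE -probE//; apply/(cvg_EFin_ratio _ _ G0).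
move=> x; pose y n := a n * x + b n.
have nG : n%:R * G (y n) @[n --> \oo] --> expR (- x).
  have := Fnorm x; under eq_fun do rewrite FE -EFinM.
  by move=> /fine_cvgP[].
have y_cvgy : y n @[n --> \oo] --> +oo.
  apply: (nonincreasing_cvg0_cvgy G0) => [u v uv|].
    by apply: le_prob => // w /=; exact: le_lt_trans.
  (* The shifted index allows division by n + 1, which shows that [G (y n)] tends to 0. *)
  have nG1 : n.+1%:R * G (y n.+1) @[n --> \oo] --> expR (- x).
    by rewrite (cvg_shiftS (fun n => n%:R * G (y n))).
  have hG := cvgM (@cvg_harmonic R) nG1; rewrite mul0r in hG.
  have G1 : G (y n.+1) @[n --> \oo] --> (0 : R).
    rewrite (_ : (fun n => G (y n.+1)) =
      harmonic \* (fun n => n.+1%:R * G (y n.+1))); first exact: hG.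
    by apply/funext => n /=; rewrite mulrA mulVf ?mul1r// pnatr_eq0.
  by move: G1; rewrite (cvg_shiftS (fun n => G (y n))).
have ratio : prob P [set w | y n < S w] / G (y n) @[n --> \oo]
    --> 1 + \sum_(i < d | i != i1) c i.
  exact: (cvg_comp y (fun u => prob P [set w | u < S w] / G u) y_cvgy main).
under eq_fun do rewrite -probE// -EFinM.
apply: cvg_EFin; first exact: nearW.
(* n P(S > y_n) is the product of P(S > y_n) / G(y_n) and n G(y_n), whose limits are known. *)
rewrite (_ : fine \o _ = (fun n => prob P [set w | y n < S w] / G (y n))
  \* (fun n => n%:R * G (y n))); first exact: cvgM.
by apply/funext => n /=; rewrite mulrCA divfK// gt_eqF.
Unshelve. all: by end_near. Qed.
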